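(* Let $F_n$ be the free group of finite rank $n$. If $H\leqslant F_n$, then $$\max\{0,\,n-\mathrm{rk}(H)\}\;\leq\;\mathrm{crk}_{\vee}(H)\;\leq\; n .$$ Moreover, for $n>1$ this is the only general restriction between the rank and the $\vee$-corank of a subgroup of $F_n$; namely, for every pair $(r,c)$ with $r\in\{1,2,3,\dots\}\cup\{\infty\}$ and $c\in\{1,\dots,n\}$ satisfying $n-r\leq c\leq n$, there exists a subgroup of $F_n$ with rank $r$ and $\vee$-corank $c$.
   Context: The rank $\mathrm{rk}(G)$ of a group $G$ is the smallest cardinality of a generating set of $G$. For a subgroup $H\leqslant F_n$, a $\vee$-complement of $H$ is a subgroup $K\leqslant F_n$ with $\langle H\cup K\rangle=F_n$, and the $\vee$-corank $\mathrm{crk}_{\vee}(H)$ is the minimum rank of a $\vee$-complement of $H$. Conventions: rank $\infty$ means countably infinite rank, and $n-\infty=-\infty$. *)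

(* Defs.v *)
From HB Require Import structures.
From mathcomp Require Import all_boot all_order all_algebra finmap.
From mathcomp Require Import boolp classical_sets functions cardinality.
From mathcomp Require Import constructive_ereal.

Set Implicit Arguments.
Unset Strict Implicit.
Unset Printing Implicit Defensive.

Import Order.TTheory GRing.Theory Num.Theory.

Local Open Scope classical_set_scope.
Local Open Scope ring_scope.

(* The free group on T, as the group of reduced words over the letters        *)
(* (x, false), standing for the generator x, and (x, true), standing for its  *)
(* inverse.                                                                   *)

Section FreeGroup.
Variable T : choiceType.
Local Notation letter := (T * bool)%type.
Implicit Types (a b : letter) (u v w : seq letter).

Definition linv a : letter := (a.1, ~~ a.2).

Definition reduced w := sorted (fun a b => b != linv a) w.

Definition push a w :=
  if w is b :: w' then if b == linv a then w' else a :: w else [:: a].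

Definition word_mul u v := foldr push v u.

Definition word_inv u := rev (map linv u).

Lemma linvK : involutive linv.
Proof. by case=> x e; rewrite /linv /= negbK. Qed.

Lemma reduced_push a w : reduced w -> reduced (push a w).
Proof.
case: w => [//|b w] /=; case: ifP => [_ /path_sorted //|nb bw].
by rewrite /reduced /= nb.
Qed.

Lemma pushK a w : reduced w -> push (linv a) (push a w) = w.
Proof.
case: w => [_ /=|b w]; first by rewrite linvK eqxx.
rewrite /reduced /=; case: (eqVneq b (linv a)) => [->|nb] /=; last first.
  by rewrite linvK eqxx.
by case: w => [//|c w] /= /andP[/negPf -> _].
Qed.

Lemma pushVK a w : reduced w -> push a (push (linv a) w) = w.
Proof. by move=> /(pushK (linv a)); rewrite linvK. Qed.

Lemma reduced_mul u v : reduced v -> reduced (word_mul u v).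
Proof. by move=> rv; elim: u => //= a u; apply: reduced_push. Qed.

Lemma word_mul_push a u v :
  reduced v -> word_mul (push a u) v = push a (word_mul u v).
Proof.
move=> rv; case: u => //= b u; case: eqP => [->|//].
by rewrite pushVK // reduced_mul.
Qed.

Lemma word_mulA u v w :
  reduced w -> word_mul u (word_mul v w) = word_mul (word_mul u v) w.
Proof.
by move=> rw; elim: u => //= a u ->; rewrite word_mul_push.
Qed.

Lemma word_mul0 u : reduced u -> word_mul u [::] = u.
Proof.
elim: u => //= a u IHu /[dup] /path_sorted ru; rewrite IHu //.
by case: u {IHu ru} => //= b u /andP[/negPf ->].
Qed.

Lemma reduced_inv u : reduced u -> reduced (word_inv u).
Proof.
rewrite /reduced /word_inv rev_sorted sorted_map; apply: sub_sorted => a b /=.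
by rewrite linvK eq_sym.
Qed.

Lemma word_invK : involutive word_inv.
Proof.
move=> u; rewrite /word_inv map_rev revK -map_comp.
by apply: map_id_in => a _ /=; rewrite linvK.
Qed.

Lemma word_mulV u : word_mul (word_inv u) u = [::].
Proof.
elim: u => // a u IHu; rewrite /word_inv /= rev_cons -cats1 /word_mul foldr_cat.
by rewrite /= linvK eqxx.
Qed.

Record free_group := FreeGroup {
  word : seq letter;
  wordP : reduced word
}.

HB.instance Definition _ := [isSub for word].
HB.instance Definition _ := [Choice of free_group by <:].

Implicit Types g h : free_group.

Definition free_one := @FreeGroup [::] isT.
Definition free_mul g h := FreeGroup (reduced_mul (word g) (wordP h)).
Definition free_inv g := FreeGroup (reduced_inv (wordP g)).

Lemma free_mulA : associative free_mul.
Proof. by move=> f g h; apply/val_inj/word_mulA/wordP. Qed.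
Lemma free_mul1g : left_id free_one free_mul.
Proof. by move=> g; apply/val_inj. Qed.
Lemma free_mulg1 : right_id free_one free_mul.
Proof. by move=> g; apply/val_inj/word_mul0/wordP. Qed.
Lemma free_mulVg : left_inverse free_one free_inv free_mul.
Proof. by move=> g; apply/val_inj/word_mulV. Qed.
Lemma free_mulgV : right_inverse free_one free_inv free_mul.
Proof.
by move=> g; apply/val_inj; rewrite /= -{1}(word_invK (word g)) word_mulV.
Qed.

HB.instance Definition _ := isGroup.Build free_group
  free_mulA free_mul1g free_mulg1 free_mulVg free_mulgV.

Definition free_gen (x : T) : free_group := @FreeGroup [:: (x, false)] isT.

Section Lift.
Variables (G : groupType) (f : T -> G).

Definition letter_lift a : G := if a.2 then ((f a.1)^-1)%g else f a.1.
Definition word_lift w : G := foldr (fun a z => (letter_lift a * z)%g) 1%g w.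
Definition free_lift g : G := word_lift (word g).

Lemma letter_liftV a : letter_lift (linv a) = ((letter_lift a)^-1)%g.
Proof. by case: a => x [] /=; rewrite /letter_lift /= ?invgK. Qed.

Lemma word_lift_push a w :
  word_lift (push a w) = (letter_lift a * word_lift w)%g.
Proof.
case: w => //= b w; case: eqP => [->|//].
by rewrite letter_liftV mulVKg.
Qed.

Lemma free_liftM : {morph free_lift : g h / (g * h)%g >-> (g * h)%g}.
Proof.
move=> [u ru] [v rv]; rewrite /free_lift /=; elim: u {ru} => [|a u IHu] /=.
  by rewrite mul1g.
by rewrite word_lift_push IHu mulgA.
Qed.

HB.instance Definition _ :=
  isMultiplicative.Build free_group G free_lift free_liftM.

Lemma free_lift_gen x : free_lift (free_gen x) = f x.
Proof. by rewrite /free_lift /= mulg1. Qed.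

End Lift.

Lemma free_genV x : (free_gen x)^-1%g = @FreeGroup [:: (x, true)] isT.
Proof. exact/val_inj. Qed.

Lemma free_lift_uniq (G : groupType) (f : T -> G)
    (phi : {multiplicative free_group -> G}) :
  (forall x, phi (free_gen x) = f x) -> phi =1 free_lift f.
Proof.
move=> phif.
have phi1 : phi 1%g = 1%g.
  by apply: (mulgI (phi 1%g)); rewrite -gmulfM !mulg1.
have phiV x : phi (x^-1)%g = ((phi x)^-1)%g.
  by apply: (mulgI (phi x)); rewrite -gmulfM !mulgV.
case; elim=> [|a w IHw] raw.
  by rewrite -[RHS]phi1; congr (phi _); apply/val_inj.
have rw : reduced w by exact: path_sorted raw.
have ra : reduced [:: a] by [].
have -> : FreeGroup raw = (FreeGroup ra * FreeGroup rw)%g.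
  apply/val_inj => /=; move: raw; rewrite /reduced /=.
  by case: w {IHw rw} => //= b w /andP[/negPf ->].
rewrite gmulfM IHw free_liftM; congr (_ * _)%g; rewrite /free_lift /= mulg1.
case: a {raw} ra => x [] ra; rewrite /letter_lift /= -phif.
  by rewrite -phiV free_genV; congr (phi _); apply/val_inj.
by congr (phi _); apply/val_inj.
Qed.

End FreeGroup.

(* Ranks and cardinalities live in \bar int: every infinite cardinality is    *)
(* recorded as +oo, which for subsets of a countable group such as F_n means  *)
(* countably infinite, and subtraction satisfies n - +oo = -oo.               *)

Local Open Scope ereal_scope.

Definition ecard (T : choiceType) (S : set T) : \bar int :=
  if `[< finite_set S >] then (#|` fset_set S|%fset : int)%:E else +oo.

(* The value +oo is a junk value if A has no smallest element, see minimumP.  *)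
Definition minimum (A : set (\bar int)) : \bar int :=
  xget +oo (A `&` lbound A).

Lemma minimumP (A : set (\bar int)) :
  A !=set0 -> (forall x, A x -> 0 <= x) -> A (minimum A) /\ lbound A (minimum A).
Proof.
move=> [x0 Ax0] A0; rewrite /minimum; case: xgetP => [x _ //|noA].
have [[k Ak]|nofin] := pselect (exists k : nat, A (k : int)%:E); last first.
  have Aoo x : A x -> x = +oo.
    move=> Ax; case: x Ax (A0 _ Ax) => // -[k|//] Ax _.
    by case: nofin; exists k.
  case: (noA +oo); split=> [|y /Aoo -> //]; by rewrite -(Aoo _ Ax0).
have exP : exists k : nat, `[< A (k : int)%:E >] by exists k; apply/asboolP.
case: (ex_minnP exP) => m /asboolP Am minm.
case: (noA (m : int)%:E); split=> // y Ay.
case: y Ay (A0 _ Ay) => [[j|//]|//|//] Ay _.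
by rewrite lee_fin lez_nat minm //; apply/asboolP.
Qed.

Section Rank.
Variable G : groupType.
Implicit Types H K S : set G.

Definition subgroup H : Prop := group_closed [in H].

Definition generated S : set G := smallest subgroup S.

Definition rk H : \bar int :=
  minimum [set ecard S | S in [set S | generated S = H]].

Definition join_complement H K : Prop :=
  subgroup K /\ generated (H `|` K) = [set: G].

Definition join_corank H : \bar int :=
  minimum [set rk K | K in [set K | join_complement H K]].

Lemma ecard_ge0 S : 0 <= ecard S.
Proof. by rewrite /ecard; case: ifP => // _; exact: leey. Qed.

Lemma subgroup_setT : subgroup [set: G].
Proof. by split=> [|x y _ _]; apply/mem_set. Qed.

Lemma rkP H : subgroup H ->
  (exists2 S, generated S = H & ecard S = rk H) /\
  (forall S, generated S = H -> rk H <= ecard S).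
Proof.
move=> sH; have [||[S genS cS] lb] :=
  @minimumP [set ecard S | S in [set S | generated S = H]].
- by exists (ecard H), H => //=; exact: smallest_id.
- by move=> _ [S _ <-]; exact: ecard_ge0.
by split=> [|S' genS']; [exists S | apply: lb; exists S'].
Qed.

Lemma join_corankP H :
  (exists2 K, join_complement H K & rk K = join_corank H) /\
  (forall K, join_complement H K -> join_corank H <= rk K).
Proof.
have [||[K cK rK] lb] := @minimumP [set rk K | K in [set K | join_complement H K]].
- exists (rk setT), setT => //=; split; first exact: subgroup_setT.
  by rewrite setUT; apply: smallest_id; exact: subgroup_setT.
- by move=> _ [K [sK _] <-]; have [[S _ <-] _] := rkP sK; exact: ecard_ge0.
by split=> [|K' cK']; [exists K | apply: lb; exists K'].
Qed.

End Rank.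

(* Main.v *)
(* Lower bounds on ranks come from linear algebra: if phi is additive on a     *)
(* subgroup L with values in F^m and phi(L) spans F^m, then L has rank at      *)
(* least m, and at least m further generators are needed to obtain L from a    *)
(* part of L on which phi vanishes.  Abelianization thus gives n <= rk H +     *)
(* rk K whenever H and K generate F_n.                                         *)
(* For the pair (r, c), put k = n - c, b = x_0 and a = x_(n-1), and let H be   *)
(* generated by h_l for l < r, with h_l = x_l if l < k and h_l = a^l b^2 a^-l  *)
(* otherwise.  Modulo 2 the abelianization of H is spanned by the first k      *)
(* basis vectors, so the corank of H is n - k = c.  Mapping a to the shift and *)
(* the other x_i to the basis vectors e_i in the wreath product of a field     *)
(* with the integers sends h_l to e_l or 2 e_l, so H has rank r if 2 != 0.     *)

From HB Require Import structures.
Require Import Defs.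
From mathcomp Require Import all_boot all_order all_algebra finmap.
From mathcomp Require Import boolp cardinality.
From mathcomp Require Import classical_sets constructive_ereal.
From mathcomp Require Import zify.

Set Implicit Arguments.
Unset Strict Implicit.
Unset Printing Implicit Defensive.

Import Order.TTheory GRing.Theory Num.Theory.

Local Open Scope classical_set_scope.
Local Open Scope ring_scope.

(** Every lower bound is a dimension count ([size_generators_ge]), applied to coordinates of a
    homomorphism into a wreath product ([lamp_size_generators_ge]). Generators of H and of a
    complement together generate F_n, whose abelianization has dimension n; this gives
    [rk_join_corank_ge]. Conversely, a subgroup containing the first k free generators is completed
    by the other n - k ([join_corank_le]), and k = 0 yields the bound n. For existence, one subgroup
    [witness] is seen over two fields. Characteristic 2 kills the squares, so only the first k
    coordinates remain visible and n - k more generators are necessary ([join_corank_witness]). In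
    characteristic 3 the squares survive, and conjugation by powers of a puts them at different
    positions, so the rank is r ([rk_witness]). *)

Section GeneratedSubgroup.
Variable G : groupType.
Implicit Types (H S : set G) (s : seq G) (x y : G).

Lemma subgroupP H :
  subgroup H <-> H 1%g /\ forall x y, H x -> H y -> H (x * y^-1)%g.
Proof.
split=> [[/set_mem H1 HB]|[H1 HB]].
  by split=> // x y /mem_set Hx /mem_set Hy; apply/set_mem/HB.
split=> [|x y /set_mem Hx /set_mem Hy]; apply/mem_set => //; exact: HB.
Qed.

Lemma subgroup1 H : subgroup H -> H 1%g.
Proof. by case/subgroupP. Qed.

Lemma subgroupV H x : subgroup H -> H x -> H (x^-1)%g.
Proof. by case/subgroupP=> H1 HB Hx; rewrite -div1g; apply: HB. Qed.

Lemma subgroupM H x y : subgroup H -> H x -> H y -> H (x * y)%g.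
Proof.
move=> sH Hx Hy; have /subgroupP[_ HB] := sH.
by rewrite -[y]invgK; apply: HB => //; apply: subgroupV.
Qed.

Lemma generated_subgroup S : subgroup (generated S).
Proof.
apply/subgroupP; split=> [L [sL _]|x y Sx Sy L [sL SL]]; first exact: subgroup1.
by apply: subgroupM => //; [apply: Sx|apply: subgroupV => //; apply: Sy].
Qed.

Lemma sub_generated S : S `<=` generated S.
Proof. exact: sub_gen_smallest. Qed.

Lemma generated_sub H S : subgroup H -> S `<=` H -> generated S `<=` H.
Proof. exact: smallest_sub. Qed.

(** * Counting generators by linear algebra *)

Section RankBound.
Variables (F : fieldType) (m : nat) (L : set G) (phi : G -> 'rV[F]_m).
Hypothesis phiM : forall x y, L x -> L y -> phi (x * y)%g = phi x + phi y.

(** The elements of [L] whose image lies in the span of the images of [s] form a subgroup containing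
    [Z] and [s], hence all of [L]; so these images span F^m. *)
Lemma size_generators_ge (Z : set G) s :
  generated (Z `|` [set` s]) = L -> (forall x, Z x -> phi x = 0) ->
  (forall i : 'I_m, exists2 x, L x & (delta_mx (0 : 'I_1) i <= phi x)%MS) ->
  (m <= size s)%N.
Proof.
move=> genL phiZ phi_full.
have sL : subgroup L by rewrite -genL; apply: generated_subgroup.
have sZL : Z `|` [set` s] `<=` L by rewrite -genL; apply: sub_generated.
have phi1 : phi 1%g = 0.
  by apply: (addrI (phi 1%g)); rewrite -phiM ?mulg1 ?addr0 //; apply: subgroup1.
have phiV x : L x -> phi (x^-1)%g = - phi x.
  move=> Lx; apply/eqP; rewrite -addr_eq0 -phiM ?mulVg ?phi1 //.
  exact: subgroupV.
pose A : 'M_(size s, m) := \matrix_i phi (nth 1%g s i).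
have LA : L `<=` [set x | L x /\ (phi x <= A)%MS].
  rewrite -{1}genL; apply: generated_sub => [|x ZSx].
    apply/subgroupP; split=> [|x y [Lx Ax] [Ly Ay]] /=.
      by split; [apply: subgroup1|rewrite phi1 sub0mx].
    have LVy := subgroupV sL Ly.
    by rewrite phiM ?phiV // addmx_sub ?eqmx_opp //; split=> //; apply: subgroupM.
  split; first exact: sZL.
  case: ZSx => [/phiZ ->|/= sx]; first exact: sub0mx.
  have ltx : (index x s < size s)%N by rewrite index_mem.
  have -> : phi x = row (Ordinal ltx) A by rewrite rowK /= nth_index.
  exact: row_sub.
have : (1%:M <= A)%MS.
  apply/row_subP=> i; have [x /LA[_ Ax] di] := phi_full i.
  by rewrite row1; apply: submx_trans Ax.
by move/mxrankS; rewrite mxrank1 => /leq_trans; apply; apply: rank_leq_row.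
Qed.

End RankBound.

End GeneratedSubgroup.

(** * Cardinalities as extended integers *)

Lemma ecard_seq_le (T : choiceType) (s : seq T) :
  (ecard [set` s] <= (size s : int)%:E)%E.
Proof.
rewrite /ecard; case: asboolP => [fs|[]]; last exact: finite_seq.
rewrite lee_fin lez_nat.
have -> : [set` s] = [set` [fset x in s]%fset].
  by apply/seteqP; split=> x /=; rewrite inE.
by rewrite set_fsetK card_imfset //= size_undup.
Qed.

Lemma ecardP (T : choiceType) (S : set T) : ecard S != +oo%E ->
  exists2 s : seq T, S = [set` s] & ecard S = (size s : int)%:E.
Proof.
rewrite /ecard; case: asboolP => [fS _|//].
by exists (fset_set S); first rewrite fset_setK.
Qed.

Lemma ereal_int_le_nat (r x : \bar int) : (0 <= r)%E ->
  (forall m : nat, ((m : int)%:E <= r)%E -> ((m : int)%:E <= x)%E) -> (r <= x)%E.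
Proof.
case: r => [[m|//]||//] _ rx; first exact: rx.
have {}rx m := rx m (leey _).
case: x rx => [z rx|//|rx]; last exact: rx 0%N.
(* Here r = +oo; a finite [x] equal to [z] would be exceeded by |z| + 1. *)
by have := rx `|z|.+1%N; rewrite lee_fin; lia.
Qed.

(** * Free generators and homomorphisms out of the free group *)

Section FreeGroupGenerators.
Variable T : choiceType.

Lemma generated_free_gen (L : set (free_group T)) :
  subgroup L -> (forall x, L (free_gen x)) -> L = [set: free_group T].
Proof.
move=> sL Lgen; apply/seteqP; split=> // -[w rw] _; elim: w rw => [|a w IHw] raw.
  have -> : FreeGroup raw = 1%g by apply/val_inj.
  exact: subgroup1.
have rw : reduced w by exact: path_sorted raw.
have ra : reduced [:: a] by [].
have -> : FreeGroup raw = (FreeGroup ra * FreeGroup rw)%g.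
  apply/val_inj => /=; move: raw; rewrite /reduced /=.
  by case: w {IHw rw} => //= b w /andP[/negPf ->].
apply: subgroupM => //; case: a {raw} ra => x [] ra.
  suff -> : FreeGroup ra = (free_gen x)^-1%g by apply: subgroupV.
  by rewrite free_genV; apply/val_inj.
suff -> : FreeGroup ra = free_gen x by [].
exact/val_inj.
Qed.

HB.instance Definition _ (G : groupType) (f : T -> G) :=
  Multiplicative_isUMagmaMorphism.Build _ _ (free_lift f) erefl.

End FreeGroupGenerators.

(* The unrestricted wreath product of F with the group of integers.           *)
Definition lamp (F : zmodType) : Type := (int * (int -> F))%type.

Section Lamplighter.
Variable F : zmodType.
Implicit Types x y : lamp F.

HB.instance Definition _ := Choice.copy (lamp F) (int * (int -> F))%type.

Definition lamp_one : lamp F := (0, fun=> 0).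
Definition lamp_mul x y : lamp F :=
  (x.1 + y.1, fun i => x.2 i + y.2 (i - x.1)).
Definition lamp_inv x : lamp F := (- x.1, fun i => - x.2 (i + x.1)).

Lemma lamp_mulA : associative lamp_mul.
Proof.
move=> x y z; rewrite /lamp_mul /= addrA; congr pair.
by apply/funext=> i; rewrite addrA opprD addrA.
Qed.

Lemma lamp_mul1g : left_id lamp_one lamp_mul.
Proof.
case=> e f; rewrite /lamp_mul /= add0r; congr pair.
by apply/funext=> i; rewrite add0r subr0.
Qed.

Lemma lamp_mulg1 : right_id lamp_one lamp_mul.
Proof.
case=> e f; rewrite /lamp_mul /= addr0; congr pair.
by apply/funext=> i; rewrite addr0.
Qed.

Lemma lamp_mulVg : left_inverse lamp_one lamp_inv lamp_mul.
Proof.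
move=> x; rewrite /lamp_mul /= addNr; congr pair.
by apply/funext=> i; rewrite opprK addNr.
Qed.

Lemma lamp_mulgV : right_inverse lamp_one lamp_inv lamp_mul.
Proof.
move=> x; rewrite /lamp_mul /= subrr; congr pair.
by apply/funext=> i; rewrite subrK subrr.
Qed.

HB.instance Definition _ := isGroup.Build (lamp F)
  lamp_mulA lamp_mul1g lamp_mulg1 lamp_mulVg lamp_mulgV.

Definition lamp_shift (e : int) : lamp F := (e, fun=> 0).
Definition lamp_base (f : int -> F) : lamp F := (0, f).

Lemma lamp_fstM x y : (x * y)%g.1 = x.1 + y.1. Proof. by []. Qed.
Lemma lamp_sndM x y i : (x * y)%g.2 i = x.2 i + y.2 (i - x.1). Proof. by []. Qed.
Lemma lamp_fstV x : (x^-1)%g.1 = - x.1. Proof. by []. Qed.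
Lemma lamp_sndV x i : (x^-1)%g.2 i = - x.2 (i + x.1). Proof. by []. Qed.

Lemma lamp_shiftX l : (lamp_shift 1 ^+ l)%g = lamp_shift l%:Z.
Proof.
elim: l => // l IHl; rewrite expgS IHl /lamp_shift; congr pair.
by apply/funext=> i; rewrite /= addr0.
Qed.

Lemma lamp_conj_shift e f :
  (lamp_shift e * lamp_base f * (lamp_shift e)^-1)%g
  = lamp_base (fun i => f (i - e)).
Proof.
congr pair; first by rewrite /= addr0 subrr.
by apply/funext=> i; rewrite /= add0r oppr0 addr0.
Qed.

End Lamplighter.

(** * Counting generators through the wreath product *)

Section LampRankBound.
Variables (F : fieldType) (G : groupType) (rho : UMagmaMorphism.type G (lamp F)).

Lemma lamp_kernel_subgroup : subgroup [set x | (rho x).1 = 0].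
Proof.
apply/subgroupP; split=> [|x y /= x0 y0]; first by rewrite /= gmulf1.
by rewrite gmulfF lamp_fstM x0 lamp_fstV y0 oppr0 addr0.
Qed.

(** On [L] the shift part vanishes, so second components add pointwise and the coordinates k, ..., k
    + m - 1 give an additive map to F^m. *)
Lemma lamp_size_generators_ge (k m : nat) (L Z : set G) (s : seq G) :
  generated (Z `|` [set` s]) = L -> L `<=` [set x | (rho x).1 = 0] ->
  (forall x, Z x -> forall i : 'I_m, (rho x).2 (k + i)%N%:Z = 0) ->
  (forall i : 'I_m, exists x, L x /\ exists2 a : F, a != 0 &
     (rho x).2 = fun j => a * (j == (k + i)%N%:Z)%:R) ->
  (m <= size s)%N.
Proof.
move=> genL L0 Z0 Lfull.
pose phi x := \row_(i < m) (rho x).2 (k + i)%N%:Z.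
apply: (@size_generators_ge _ _ _ L phi _ Z) => //.
- move=> x y Lx Ly; apply/rowP=> i.
  by rewrite !mxE gmulfM lamp_sndM (L0 x Lx) subr0.
- by move=> x Zx; apply/rowP=> i; rewrite !mxE Z0.
move=> i; have [x [Lx [a a0 rx]]] := Lfull i; exists x => //.
have -> : phi x = a *: delta_mx 0 i.
  by apply/rowP=> j; rewrite !mxE rx eqxx /= eqz_nat eqn_add2l.
by rewrite eqmx_scale.
Qed.

End LampRankBound.

Definition lamp_delta (F : fieldType) (l : nat) : lamp F :=
  lamp_base (fun j => (j == l%:Z)%:R).

(** * Abelianization and bounds on the corank *)

Section Corank.
Variables (F : fieldType) (n : nat).

(** Abelianization over [F], placed in the shift-free part of the wreath product so that the same
    counting lemma serves for corank and rank. *)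
Definition abel : UMagmaMorphism.type (free_group 'I_n) (lamp F) :=
  free_lift (fun i : 'I_n => lamp_delta F i).

Lemma abel_gen i : abel (free_gen i) = lamp_delta F i.
Proof. exact: free_lift_gen. Qed.

Lemma abel_fst g : (abel g).1 = 0.
Proof.
suff : [set x | (abel x).1 = 0] g by [].
rewrite (@generated_free_gen _ [set x | (abel x).1 = 0]) //.
exact: lamp_kernel_subgroup.
Qed.

Lemma size_complement_ge (k : nat) (Z : set (free_group 'I_n)) s :
  generated (Z `|` [set` s]) = setT ->
  (forall x, Z x -> forall i, (k <= i)%N -> (abel x).2 i%:Z = 0) ->
  (n - k <= size s)%N.
Proof.
move=> genZ Z0; apply: (lamp_size_generators_ge (rho := abel) (k := k) genZ).
- by move=> x _; apply: abel_fst.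
- by move=> x Zx i; apply: Z0 => //; apply: leq_addr.
move=> i; have lti : (k + i < n)%N by rewrite -ltn_subRL.
exists (free_gen (Ordinal lti)); split=> //; exists 1; first exact: oner_neq0.
by rewrite abel_gen; apply/funext=> j; rewrite mul1r.
Qed.

End Corank.

Lemma generatedU_sub (G : groupType) (A B : set G) :
  generated (generated A `|` generated B) `<=` generated (A `|` B).
Proof.
apply: generated_sub => [|x]; first exact: generated_subgroup.
case=> /generated_sub; apply; try exact: generated_subgroup.
  by move=> y Ay; apply: sub_generated; left.
by move=> y By; apply: sub_generated; right.
Qed.

Lemma rk_join_corank_ge n (H : set (free_group 'I_n)) : subgroup H ->
  ((n : int)%:E - rk H <= join_corank H)%E.
Proof.
move=> sH; have [[S genS <-] _] := rkP sH.
have [[K [sK genHK] <-] _] := join_corankP H.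
have [[S' genS' <-] _] := rkP sK.
(* An infinite [S] makes the left side -oo; an infinite [S'] makes the right side +oo. *)
have [->|/ecardP[s defS ->]] := eqVneq (ecard S) +oo%E; first exact: leNye.
have [->|/ecardP[s' defS' ->]] := eqVneq (ecard S') +oo%E; first exact: leey.
have : (n - 0 <= size (s ++ s'))%N.
  apply: (@size_complement_ge rat n 0 set0) => //.
  have -> : [set` s ++ s'] = S `|` S'.
    by rewrite defS defS'; apply/seteqP; split=> x /=; rewrite mem_cat => /orP.
  apply/seteqP; split=> // x _; rewrite set0U; apply: generatedU_sub.
  by rewrite genS genS' genHK.
by rewrite size_cat -EFinB lee_fin; lia.
Qed.

Lemma mem_drop_enum n k (i : 'I_n) : (k <= i)%N -> i \in drop k (enum 'I_n).
Proof.
move=> ki; rewrite -(nth_ord_enum i i) -(subnKC ki) -nth_drop mem_nth //.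
by rewrite size_drop size_enum_ord ltn_sub2r // (leq_ltn_trans ki).
Qed.

(** The free generators of index at least k generate a complement. *)
Lemma join_corank_le n k (H : set (free_group 'I_n)) :
  subgroup H -> (forall i : 'I_n, (i < k)%N -> H (free_gen i)) ->
  (join_corank H <= ((n - k)%N : int)%:E)%E.
Proof.
move=> sH Hgen.
pose s : seq (free_group 'I_n) := map (@free_gen 'I_n) (drop k (enum 'I_n)).
have -> : (n - k)%N = size s by rewrite size_map size_drop size_enum_ord.
have [_ /(_ (generated [set` s])) crkH] := join_corankP H.
have [_ /(_ [set` s] erefl) rks] := rkP (generated_subgroup [set` s]).
apply: (le_trans (crkH _)); last exact: le_trans rks (ecard_seq_le s).
split; first exact: generated_subgroup.
apply: generated_free_gen => [|i]; first exact: generated_subgroup.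
apply: sub_generated; have [ik|ki] := ltnP i k; first by left; apply: Hgen.
by right; apply: sub_generated; apply: map_f; apply: mem_drop_enum.
Qed.

Lemma join_corank_ge0 (G : groupType) (H : set G) : (0 <= join_corank H)%E.
Proof.
have [[K [sK _] <-] _] := join_corankP H.
by have [[S _ <-] _] := rkP sK; apply: ecard_ge0.
Qed.

(** * Subgroups realizing a given rank and corank *)

Section Witness.
Variable n : nat.
Hypothesis n_gt0 : (0 < n)%N.
Local Notation gen := (@free_gen 'I_n.+1).

Definition witness_gen (k l : nat) : free_group 'I_n.+1 :=
  if (l < k)%N then gen (inord l)
  else (gen ord_max ^+ l * (gen ord0 ^+ 2) * (gen ord_max ^+ l)^-1)%g.

(** Comparing in [\bar int] treats finite r and r = +oo alike: the latter admits every index. *)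
Definition witness (k : nat) (r : \bar int) : set (free_group 'I_n.+1) :=
  generated [set witness_gen k l | l in [set l : nat | (l%:Z%:E < r)%E]].

(** Conjugates of b^2 by powers of a coincide in the abelianization; sending a to the shift makes
    them independent. *)
Definition shift_rep (F : fieldType) :
    UMagmaMorphism.type (free_group 'I_n.+1) (lamp F) :=
  free_lift (fun i : 'I_n.+1 =>
    if i == ord_max then lamp_shift F 1 else lamp_delta F i).

Lemma shift_rep_gen F i : shift_rep F (gen i) =
  if i == ord_max then lamp_shift F 1 else lamp_delta F i.
Proof. exact: free_lift_gen. Qed.

Lemma shift_rep_witness_gen F k l : (k <= n)%N ->
  shift_rep F (witness_gen k l) = lamp_base (fun j =>
    (if (l < k)%N then 1 else 2%:R) * (j == l%:Z)%:R).
Proof.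
move=> kn; rewrite /witness_gen; case: ifP => lk.
  have ln : (l < n)%N by apply: leq_trans kn.
  rewrite shift_rep_gen -val_eqE /= inordK ?ltnS 1?ltnW // ltn_eqF //.
  by congr pair; apply/funext=> j; rewrite mul1r.
(* [n_gt0] separates [ord0] from [ord_max]: b goes to a basis vector at position 0, which the shift
   then carries to l. *)
rewrite !gmulfM gmulfV !gmulfXn !shift_rep_gen eqxx -val_eqE /= ltn_eqF //.
have -> : (lamp_delta F 0 * lamp_delta F 0)%g = lamp_base (fun j => 2%:R * (j == 0)%:R).
  by congr pair; apply/funext=> j; rewrite /= subr0 mulr_natl mulr2n.
rewrite lamp_shiftX lamp_conj_shift; congr pair; apply/funext=> j.
by rewrite subr_eq0.
Qed.

Lemma abel_witness_gen k l i : (k <= n)%N -> (k <= i)%N ->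
  (abel 'F_2 n.+1 (witness_gen k l)).2 i%:Z = 0.
Proof.
move=> kn ki; rewrite /witness_gen; case: ifP => lk.
  rewrite abel_gen /= inordK; last by rewrite ltnS ltnW // (leq_trans lk).
  by rewrite eqz_nat gtn_eqF // (leq_trans lk).
rewrite !gmulfM gmulfV !lamp_sndM lamp_sndV !lamp_fstM !abel_fst.
(* The conjugating powers cancel and b^2 contributes twice the same value, zero in characteristic
   2. *)
by rewrite !(addr0, subr0) addrr_pchar2 // addr0 subrr.
Qed.

Lemma rk_witness k r : (k <= n)%N -> (0 <= r)%E -> rk (witness k r) = r.
Proof.
move=> kn r0; have [[S genS cS] rk_le] := rkP (generated_subgroup
  [set witness_gen k l | l in [set l : nat | (l%:Z%:E < r)%E]]).
apply/le_anti/andP; split.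
  case: r r0 {S genS cS} rk_le => [[m|//] _|_|//] rk_le; last exact: leey.
  pose s := map (witness_gen k) (iota 0 m).
  apply: le_trans (rk_le [set` s] _) _.
    congr generated; apply/seteqP; split=> x /=.
      by case/mapP=> l; rewrite mem_iota => /= lm ->; exists l; rewrite ?lte_fin.
    by case=> l; rewrite lte_fin => lm <-; apply: map_f; rewrite mem_iota.
  by rewrite (le_trans (ecard_seq_le s)) // size_map size_iota.
apply: ereal_int_le_nat => // m mr; rewrite -/(witness k r) in cS genS *.
rewrite -cS; have [->|/ecardP[s defS ->]] := eqVneq (ecard S) +oo%E.
  exact: leey.
rewrite lee_fin lez_nat.
(* In ['F_3] both possible coefficients, 1 and 2, are nonzero. *)
apply: (lamp_size_generators_ge (rho := shift_rep 'F_3) (k := 0)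
  (L := witness k r) (Z := set0)) => //; first by rewrite set0U -defS.
  apply: generated_sub; first exact: lamp_kernel_subgroup.
  by move=> _ [l _ <-] /=; rewrite shift_rep_witness_gen.
move=> i; exists (witness_gen k i); split.
  apply: sub_generated; exists (i : nat) => //=; apply: lt_le_trans mr.
  by rewrite lte_fin ltz_nat.
rewrite shift_rep_witness_gen //.
by exists (if (i < k)%N then 1 else 2%:R); first case: ifP.
Qed.

Lemma join_corank_witness k r : (k <= n)%N -> (k%:Z%:E <= r)%E ->
  join_corank (witness k r) = (n.+1 - k)%N%:Z%:E.
Proof.
move=> kn kr; have sH : subgroup (witness k r) by apply: generated_subgroup.
apply/le_anti/andP; split.
  apply: join_corank_le => // i ik; apply: sub_generated; exists (i : nat) => /=.
    by apply: lt_le_trans kr; rewrite lte_fin ltz_nat.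
  by rewrite /witness_gen ik inord_val.
have [[K [sK genHK] <-] _] := join_corankP (witness k r).
have [[S genS <-] _] := rkP sK.
have [->|/ecardP[s defS ->]] := eqVneq (ecard S) +oo%E; first exact: leey.
pose Z := [set witness_gen k l | l in [set l : nat | (l%:Z%:E < r)%E]].
rewrite lee_fin lez_nat.
apply: (@size_complement_ge 'F_2 n.+1 k Z).
  apply/seteqP; split=> // x _; apply: generatedU_sub.
  by rewrite -defS genS genHK.
by move=> _ [l _ <-] i; apply: abel_witness_gen.
Qed.

End Witness.

Local Open Scope ereal_scope.

Theorem lemma5p2 (n : nat) :
  (forall H : set (free_group 'I_n), subgroup H ->
     maxe 0 ((n : int)%:E - rk H) <= join_corank H <= (n : int)%:E) /\
  ((1 < n)%N ->
   forall (r : \bar int) (c : nat),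
     1 <= r -> (1 <= c <= n)%N ->
     (n : int)%:E - r <= (c : int)%:E <= (n : int)%:E ->
     exists H : set (free_group 'I_n),
       [/\ subgroup H, rk H = r & join_corank H = (c : int)%:E]).
Proof.
split=> [H sH|].
  rewrite ge_max join_corank_ge0 rk_join_corank_ge //=.
  by have := @join_corank_le n 0 H sH; rewrite subn0; apply.
case: n => [//|n] n_gt0 r c r1 /andP[c0 cn] /andP[rc _].
(* With k = n + 1 - c, the hypothesis relating r and c says k <= r, while c >= 1 says k <= n, which
   keeps a out of the first k generators. *)
have kr : (n.+1 - c)%N%:Z%:E <= r.
  case: r r1 rc => [r _|_ _|//]; last exact: leey.
  by rewrite -EFinB !lee_fin; lia.
exists (witness (n.+1 - c) r); split.
- exact: generated_subgroup.
- by rewrite rk_witness //; [lia|exact: le_trans r1].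
by rewrite join_corank_witness //; [rewrite subKn|lia].
Qed.
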